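(* Let $X$ be a twisted virtual bikeigebra, and let $D$ and $D'$ be twisted virtual handlebody-link diagrams such that $D'$ is obtained from $D$ by a single twisted virtual handlebody-link Reidemeister move. Then the set $\mathcal{C}(D,X)$ of $X$-colorings of $D$ and the set $\mathcal{C}(D',X)$ of $X$-colorings of $D'$ are in one-to-one correspondence.
   Context: **Diagrams.** A twisted virtual handlebody-link diagram is an unoriented planar diagram of a trivalent graph (circle components without vertices are allowed) whose double points are each either a classical crossing (with over/under information) or a virtual crossing (no over/under information), and whose edges may carry finitely many twist bars (marked points away from crossings and vertices). The semiarcs of a diagram are the pieces obtained by cutting it at all vertices, all twist bars and all classical and virtual crossings (at a crossing both strands are cut); a circle component with no such points is a single semiarc. **Reidemeister moves.** Up to planar isotopy, the moves are the following local replacements, in either direction. - rI: add or remove a kink with one classical crossing (either sign). - rII: add or remove a bigon between two strands with two classical crossings, one strand being over at both. - rIII: the classical triangle move with three classical crossings (a strand moves over, under or between the two strands of a classical crossing, in the usual way). - vI, vII, vIII: the same three moves with all crossings virtual. - v: a strand meeting the two strands of a classical crossing only in virtual crossings is moved across that classical crossing. - rIV: two edges adjacent at a vertex which cross each other once classically (either choice of over/under) next to the vertex are untwisted, removing the crossing. - rV: a strand crossing over one edge at a vertex (respectively, under) is moved across the vertex so that it crosses over (respectively, under) the other two edges. - rVI (IH-move): an edge joining two distinct vertices and carrying no crossings or bars, with four outer ends $a,b,c,d$ in cyclic order, whose two vertices join $a,b$ and $c,d$ respectively, is replaced by an edge whose two vertices join $b,c$ and $d,a$ respectively. - tI: two consecutive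 twist bars on an edge are added or removed. - tII: a twist bar is moved along its strand through a virtual crossing. - tIII: a classical crossing between two strands with a twist bar on each of its four ends is replaced by three consecutive crossings between the two strands, virtual, classical, virtual, with no twist bars, where the strand that was under at the original classical crossing is over at the new one. - tIV: a vertex with a twist bar on each of its three edges is replaced by a vertex without twist bars, two adjacent edges of which cross each other once virtually next to the vertex. - tV: a strand crossing one edge at a vertex virtually is moved across the vertex so that it crosses the other two edges virtually. Twisted virtual handlebody-links are equivalence classes of diagrams under these moves. **Twisted virtual bikeigebras.** A twisted virtual bikeigebra is a set $X$ with three binary operations $\underline{\ast},\overline{\ast},\circledast: X\times X\to X$, one partially defined operation $(x,y)\mapsto xy$, and an involution $T:X\to X$ (so $T\circ T=\mathrm{id}$), satisfying the following axioms. (i) For all $x\in X$: $x\,\underline{\ast}\,x=x\,\overline{\ast}\,x$. (ii) For all $x,y\in X$: $(x\,\underline{\ast}\,y)\,\underline{\ast}\,y=x$; $(x\,\overline{\ast}\,y)\,\overline{\ast}\,y=x$; $x\,\underline{\ast}\,(y\,\overline{\ast}\,x)=x\,\underline{\ast}\,y$; $x\,\overline{\ast}\,(y\,\underline{\ast}\,x)=x\,\overline{\ast}\,y$; $(x\circledast y)\circledast y=x$; $x\circledast(y\circledast x)=x\circledast y$. (iii) For all $x,y,z\in X$: $(x\,\underline{\ast}\,y)\,\underline{\ast}\,(z\,\underline{\ast}\,y)=(x\,\underline{\ast}\,z)\,\underline{\ast}\,(y\,\overline{\ast}\,z)$; $(x\,\underline{\ast}\,y)\,\overline{\ast}\,(z\,\underline{\ast}\,y)=(x\,\overline{\ast}\,z)\,\underline{\ast}\,(y\,\overline{\ast}\,z)$;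 $(x\,\overline{\ast}\,y)\,\overline{\ast}\,(z\,\overline{\ast}\,y)=(x\,\overline{\ast}\,z)\,\overline{\ast}\,(y\,\underline{\ast}\,z)$; $(x\,\underline{\ast}\,y)\circledast(z\circledast y)=(x\circledast z)\,\underline{\ast}\,(y\circledast z)$; $(x\,\overline{\ast}\,y)\circledast(z\circledast y)=(x\circledast z)\,\overline{\ast}\,(y\circledast z)$; $(x\circledast y)\circledast(z\,\overline{\ast}\,y)=(x\circledast z)\circledast(y\,\underline{\ast}\,z)$; $(x\circledast y)\circledast(z\circledast y)=(x\circledast z)\circledast(y\circledast z)$. (iv) For elements where the operation $(x,y)\mapsto xy$ is defined, the operation is associative and we have $xy=z\iff yz=x\iff zx=y$, and $xy=(y\,\overline{\ast}\,x)(x\,\underline{\ast}\,y)$; $xy=(y\,\underline{\ast}\,x)(x\,\overline{\ast}\,y)$; $(xy)\,\underline{\ast}\,z=(x\,\underline{\ast}\,z)(y\,\underline{\ast}\,(z\,\overline{\ast}\,x))$; $(xy)\,\overline{\ast}\,z=(x\,\overline{\ast}\,z)(y\,\overline{\ast}\,(z\,\underline{\ast}\,x))$; $(xy)\circledast z=(x\circledast z)(y\circledast(z\circledast x))$; $x\,\underline{\ast}\,(yz)=(x\,\underline{\ast}\,y)\,\underline{\ast}\,z$; $x\,\overline{\ast}\,(yz)=(x\,\overline{\ast}\,y)\,\overline{\ast}\,z$; $x\circledast(yz)=(x\circledast y)\circledast z$. (v) For all $x,y\in X$: $T(x\circledast y)=T(x)\circledast y$; $x\circledast y=x\circledast T(y)$;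 $T(T(x)T(y))=(y\circledast x)(x\circledast y)$; $T(T(x)\,\underline{\ast}\,T(y))=[(x\circledast y)\,\overline{\ast}\,(y\circledast x)]\circledast[(y\circledast x)\,\underline{\ast}\,(x\circledast y)]$; $T(T(x)\,\overline{\ast}\,T(y))=[(x\circledast y)\,\underline{\ast}\,(y\circledast x)]\circledast[(y\circledast x)\,\overline{\ast}\,(x\circledast y)]$. **Colorings.** An $X$-coloring of a diagram $D$ is an assignment of an element of $X$ to each semiarc of $D$ such that: - at each classical crossing whose under strand has its two semiarcs colored $a,a'$ and whose over strand has its two semiarcs colored $b,b'$, we have $a'=a\,\underline{\ast}\,b$ and $b'=b\,\overline{\ast}\,a$; - at each virtual crossing whose strands have semiarcs colored $a,a'$ and $b,b'$, we have $a'=a\circledast b$ and $b'=b\circledast a$; - at each twist bar the semiarcs on the two sides are colored $x$ and $T(x)$ for some $x\in X$; - at each vertex whose three incident semiarc ends are colored $x,y,z$ in clockwise order, the product $xy$ is defined and $xy=z$ (the starting semiarc does not matter, since $xy=z\iff yz=x\iff zx=y$). $\mathcal{C}(D,X)$ denotes the set of $X$-colorings of $D$. *)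

(* Defs.v *)
From Stdlib Require Import List Permutation.
From HB Require Import structures.
From mathcomp Require Import all_boot.

Set Implicit Arguments.
Unset Strict Implicit.
Unset Printing Implicit Defensive.

(* [under], [over], [virt] are the underlined star, the overlined star and the
   circled star.  The partial product is [mul]: [mul x y = Some z] means that
   xy is defined and equal to z. *)
Record tvb_ops := TVBOps {
  carrier :> Type;
  under : carrier -> carrier -> carrier;
  over : carrier -> carrier -> carrier;
  virt : carrier -> carrier -> carrier;
  mul : carrier -> carrier -> option carrier;
  T : carrier -> carrier
}.

Declare Scope tvb_scope.
Local Open Scope tvb_scope.
Notation "x *_ y" := (under x y) (at level 40, left associativity) : tvb_scope.
Notation "x *^ y" := (over x y) (at level 40, left associativity) : tvb_scope.
Notation "x ** y" := (virt x y) (at level 40, left associativity) : tvb_scope.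
Notation "x *? y" := (mul x y) (at level 40, left associativity) : tvb_scope.

(* An equation both of whose sides involve the partial product is an equality
   in [option]: one side is defined if and only if the other one is, and then
   they are equal. *)
Record tvb := TVB {
  tvb_struct :> tvb_ops;

  tvb_barK : forall x : tvb_struct, T (T x) = x;

  tvb_diag : forall x : tvb_struct, x *_ x = x *^ x;

  tvb_underK : forall x y : tvb_struct, (x *_ y) *_ y = x;
  tvb_overK : forall x y : tvb_struct, (x *^ y) *^ y = x;
  tvb_under_over : forall x y : tvb_struct, x *_ (y *^ x) = x *_ y;
  tvb_over_under : forall x y : tvb_struct, x *^ (y *_ x) = x *^ y;
  tvb_virtK : forall x y : tvb_struct, (x ** y) ** y = x;
  tvb_virt_virt : forall x y : tvb_struct, x ** (y ** x) = x ** y;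

  tvb_exch_uu : forall x y z : tvb_struct,
    (x *_ y) *_ (z *_ y) = (x *_ z) *_ (y *^ z);
  tvb_exch_uo : forall x y z : tvb_struct,
    (x *_ y) *^ (z *_ y) = (x *^ z) *_ (y *^ z);
  tvb_exch_oo : forall x y z : tvb_struct,
    (x *^ y) *^ (z *^ y) = (x *^ z) *^ (y *_ z);
  tvb_exch_uv : forall x y z : tvb_struct,
    (x *_ y) ** (z ** y) = (x ** z) *_ (y ** z);
  tvb_exch_ov : forall x y z : tvb_struct,
    (x *^ y) ** (z ** y) = (x ** z) *^ (y ** z);
  tvb_exch_vo : forall x y z : tvb_struct,
    (x ** y) ** (z *^ y) = (x ** z) ** (y *_ z);
  tvb_exch_vv : forall x y z : tvb_struct,
    (x ** y) ** (z ** y) = (x ** z) ** (y ** z);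

  tvb_mulA : forall x y z : tvb_struct,
    obind (fun w => w *? z) (x *? y) = obind (fun w => x *? w) (y *? z);
  tvb_mul_rot : forall x y z : tvb_struct, x *? y = Some z <-> y *? z = Some x;
  tvb_mul_rot2 : forall x y z : tvb_struct, y *? z = Some x <-> z *? x = Some y;
  tvb_mul_over_under : forall x y : tvb_struct, x *? y = (y *^ x) *? (x *_ y);
  tvb_mul_under_over : forall x y : tvb_struct, x *? y = (y *_ x) *? (x *^ y);
  tvb_mul_under : forall x y z : tvb_struct,
    omap (fun w => w *_ z) (x *? y) = (x *_ z) *? (y *_ (z *^ x));
  tvb_mul_over : forall x y z : tvb_struct,
    omap (fun w => w *^ z) (x *? y) = (x *^ z) *? (y *^ (z *_ x));
  tvb_mul_virt : forall x y z : tvb_struct,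
    omap (fun w => w ** z) (x *? y) = (x ** z) *? (y ** (z ** x));
  tvb_under_mul : forall x y z w : tvb_struct,
    y *? z = Some w -> x *_ w = (x *_ y) *_ z;
  tvb_over_mul : forall x y z w : tvb_struct,
    y *? z = Some w -> x *^ w = (x *^ y) *^ z;
  tvb_virt_mul : forall x y z w : tvb_struct,
    y *? z = Some w -> x ** w = (x ** y) ** z;

  tvb_bar_virt : forall x y : tvb_struct, T (x ** y) = T x ** y;
  tvb_virt_bar : forall x y : tvb_struct, x ** y = x ** T y;
  tvb_bar_mul : forall x y : tvb_struct,
    omap (@T _) (T x *? T y) = (y ** x) *? (x ** y);
  tvb_bar_under : forall x y : tvb_struct,
    T (T x *_ T y) = ((x ** y) *^ (y ** x)) ** ((y ** x) *_ (x ** y));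
  tvb_bar_over : forall x y : tvb_struct,
    T (T x *^ T y) = ((x ** y) *_ (y ** x)) ** ((y ** x) *^ (x ** y))
}.

(* A node lists the semiarcs at its ends in clockwise order.  In
   [Classical u o u' o'] the under strand is made of u, u' and the over strand
   of o, o'; in [Virtual a b a' b'] the strands are a, a' and b, b'. *)
Inductive node (S : Type) :=
| Vertex of S & S & S
| Classical of S & S & S & S
| Virtual of S & S & S & S
| TwistBar of S & S.

Definition ends S (n : node S) : seq S :=
  match n with
  | Vertex a b c => [:: a; b; c]
  | Classical a b c d | Virtual a b c d => [:: a; b; c; d]
  | TwistBar a b => [:: a; b]
  end.

Definition node_map S S' (q : S -> S') (n : node S) : node S' :=
  match n with
  | Vertex a b c => Vertex (q a) (q b) (q c)
  | Classical a b c d => Classical (q a) (q b) (q c) (q d)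
  | Virtual a b c d => Virtual (q a) (q b) (q c) (q d)
  | TwistBar a b => TwistBar (q a) (q b)
  end.

Definition turn S (n : node S) : node S :=
  match n with
  | Vertex a b c => Vertex b c a
  | Classical a b c d => Classical c d a b
  | Virtual a b c d => Virtual b c d a
  | TwistBar a b => TwistBar b a
  end.

Definition same_node S (n n' : node S) : Prop := exists j, n' = iter j (@turn S) n.

Definition same_nodes S (ns ns' : seq (node S)) : Prop :=
  exists2 ms, Permutation ns ms & Forall2 (@same_node S) ms ns'.

Section Darts.
Context {S : finType} (ns : seq (node S)).

Definition dart : finType :=
  {i : 'I_(size ns) & 'I_(size (ends (tnth (in_tuple ns) i)))}.

Definition semiarc_at (d : dart) : S := tnth (in_tuple (ends _)) (tagged d).

Definition next_dart (d : dart) : dart :=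
  Tagged (fun i => 'I_(size (ends (tnth (in_tuple ns) i)))) (ordS (tagged d)).

Definition opposite_dart (d : dart) : dart :=
  odflt d [pick d' | (d' != d) && (semiarc_at d' == semiarc_at d)].

Definition face_dart (d : dart) : dart := next_dart (opposite_dart d).

Definition adjacent_darts : rel dart :=
  [rel d d' | (d' == next_dart d) || (d' == opposite_dart d)].

(* Every semiarc joins two ends of nodes, or is a circle without nodes. *)
Definition well_joined : Prop :=
  forall s : S, #|[pred d : dart | semiarc_at d == s]| \in [:: 0; 2].

(* Euler's formula V - E + F = 2C: as each of the C connected components with
   nodes satisfies V - E + F <= 2, this says that every component has genus 0,
   i.e. that the nodes with their clockwise orders are those of a diagram drawn
   in the plane. *)
Definition genus0 : Prop :=
  size ns + fcard face_dart dart
    = fcard opposite_dart dart + (n_comp adjacent_darts dart).*2.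

End Darts.

(* A planar diagram is recorded by its semiarcs and its nodes; a circle
   component without nodes is a semiarc which is an end of no node. *)
Record diagram := Diagram {
  semiarc : finType;
  nodes : seq (node semiarc);
  _ : well_joined nodes;
  _ : genus0 nodes
}.

(* The content of a disk: [inner] is the number of semiarcs inside the disk,
   labels in L are given to the strands crossing the boundary of the disk, and
   each pair in [arcs] is a strand running through the disk without any node,
   which connects the two labels. *)
Record fragment (L : Type) := Fragment {
  inner : nat;
  fnodes : seq (node (L + 'I_inner));
  arcs : seq (L * L)
}.

(* [cross k a b c d] has its ends in clockwise order, hence strands a, c and
   b, d; k says how the strand a, c passes the strand b, d. *)
Inductive passage := Over | Under | Virt.

Definition flip k := match k with Over => Under | Under => Over | Virt => Virt end.
Definition is_classical k := k <> Virt.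

Definition cross S k (a b c d : S) : node S :=
  match k with
  | Over => Classical b c d a
  | Under => Classical a b c d
  | Virt => Virtual a b c d
  end.

Section Fragments.
Variable L : Type.
Implicit Types (a b c d : L) (k : passage).

Local Notation "! a" := (inl a) (at level 9, a at level 8).
Local Notation "# i" := (inr (inord i)) (at level 9, i at level 8).

Definition strand a b : fragment L := @Fragment L 0 [::] [:: (a, b)].

Definition strands2 a a' b b' : fragment L :=
  @Fragment L 0 [::] [:: (a, a'); (b, b')].

Definition kink k a b : fragment L :=
  @Fragment L 1 [:: cross k !a !b #0 #0] [::].

(* Ends, clockwise: a, a', b', b. *)
Definition bigon k a a' b b' : fragment L :=
  @Fragment L 2 [:: cross k !a #1 #0 !b; cross k !a' !b' #0 #1] [::].

(* Ends, clockwise: a, b, c', a', b', c.  The strands a, a' and b, b' cross, and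
   the strand c, c' passes on the side of a and b in the first triangle, and on
   the side of a' and b' in the second one. *)
Definition triangle kab kac kbc a b c a' b' c' : fragment L :=
  @Fragment L 3 [:: cross kac !a #2 #0 !c; cross kbc !b !c' #1 #2;
                    cross kab #0 #1 !a' !b'] [::].
Definition triangle' kab kac kbc a b c a' b' c' : fragment L :=
  @Fragment L 3 [:: cross kab !a !b #0 #1; cross kbc #1 #2 !b' !c;
                    cross kac #0 !c' !a' #2] [::].

(* Vertices: ends a, b, c in clockwise order. *)
Definition vertex a b c : fragment L :=
  @Fragment L 0 [:: Vertex !a !b !c] [::].
Definition twisted_vertex k a b c : fragment L :=
  @Fragment L 2 [:: cross k !a !b #0 #1; Vertex #1 #0 !c] [::].
Definition barred_vertex a b c : fragment L :=
  @Fragment L 3 [:: TwistBar !a #0; TwistBar !b #1; TwistBar !c #2;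
                    Vertex #0 #1 #2] [::].

(* Ends, clockwise: a, b, d', c, d.  The strand d, d' crosses the edge c, or the
   edges a and b; k says how the edges pass this strand. *)
Definition vertex_strand1 k a b c d d' : fragment L :=
  @Fragment L 1 [:: Vertex !a !b #0; cross k #0 !d' !c !d] [::].
Definition vertex_strand2 k a b c d d' : fragment L :=
  @Fragment L 3 [:: cross k !a #2 #0 !d; cross k !b !d' #1 #2;
                    Vertex #0 #1 !c] [::].

(* Ends, clockwise: a, b, c, d. *)
Definition edge_ab_cd a b c d : fragment L :=
  @Fragment L 1 [:: Vertex !a !b #0; Vertex !c !d #0] [::].

Definition bars2 a b : fragment L :=
  @Fragment L 1 [:: TwistBar !a #0; TwistBar #0 !b] [::].

Definition bar_virtual a b c d : fragment L :=
  @Fragment L 1 [:: TwistBar !a #0; Virtual #0 !b !c !d] [::].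
Definition virtual_bar a b c d : fragment L :=
  @Fragment L 1 [:: Virtual !a !b #0 !d; TwistBar #0 !c] [::].

Definition barred_crossing k a b c d : fragment L :=
  @Fragment L 4 [:: TwistBar !a #0; TwistBar !b #1; TwistBar !c #2;
                    TwistBar !d #3; cross k #0 #1 #2 #3] [::].
(* The ends a and d are at the first virtual crossing, b and c at the second
   one; the inner semiarcs 0, 2 belong to the strand b, d and 1, 3 to the strand
   a, c. *)
Definition virtual_classical_virtual k a b c d : fragment L :=
  @Fragment L 4 [:: Virtual !a #0 #1 !d; cross (flip k) #3 #2 #1 #0;
                    Virtual #3 !b !c #2] [::].

Inductive local_move : fragment L -> fragment L -> Prop :=
| rI k a b : is_classical k -> local_move (kink k a b) (strand a b)
| rII k a a' b b' : is_classical k ->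
    local_move (bigon k a a' b b') (strands2 a a' b b')
| rIII_over k a b c a' b' c' : is_classical k ->
    local_move (triangle k Under Under a b c a' b' c')
               (triangle' k Under Under a b c a' b' c')
| rIII_under k a b c a' b' c' : is_classical k ->
    local_move (triangle k Over Over a b c a' b' c')
               (triangle' k Over Over a b c a' b' c')
| rIII_between k a b c a' b' c' : is_classical k ->
    local_move (triangle k k (flip k) a b c a' b' c')
               (triangle' k k (flip k) a b c a' b' c')
| vI a b : local_move (kink Virt a b) (strand a b)
| vII a a' b b' :
    local_move (bigon Virt a a' b b') (strands2 a a' b b')
| vIII a b c a' b' c' :
    local_move (triangle Virt Virt Virt a b c a' b' c')
               (triangle' Virt Virt Virt a b c a' b' c')
| v_move k a b c a' b' c' : is_classical k ->
    local_move (triangle k Virt Virt a b c a' b' c')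
               (triangle' k Virt Virt a b c a' b' c')
| rIV k a b c : is_classical k ->
    local_move (twisted_vertex k a b c) (vertex a b c)
| rV k a b c d d' : is_classical k ->
    local_move (vertex_strand1 k a b c d d') (vertex_strand2 k a b c d d')
| rVI a b c d :
    local_move (edge_ab_cd a b c d) (edge_ab_cd b c d a)
| tI a b : local_move (bars2 a b) (strand a b)
| tII a b c d :
    local_move (bar_virtual a b c d) (virtual_bar a b c d)
| tIII k a b c d : is_classical k ->
    local_move (barred_crossing k a b c d)
               (virtual_classical_virtual k a b c d)
| tIV a b c :
    local_move (barred_vertex a b c) (twisted_vertex Virt a b c)
| tV a b c d d' :
    local_move (vertex_strand1 Virt a b c d d') (vertex_strand2 Virt a b c d d').

End Fragments.

(* D is obtained from the nodes E outside a disk by filling the disk with F.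
   The labels L name the strands outside the disk, including circles without
   nodes; q sends the labels and the inner semiarcs of F to the semiarcs of D,
   and identifies exactly those which are connected by the arcs of F. *)
Definition filled (D : diagram) (L : finType) (E : seq (node L))
    (F : fragment L) : Prop :=
  exists q : L + 'I_(inner F) -> semiarc D,
    [/\ forall s, exists l, q l = s,
        forall l l', q l = q l' <->
          connect [rel x y : L + 'I_(inner F) |
            has (fun p => ((x == inl p.1) && (y == inl p.2)) ||
                          ((y == inl p.1) && (x == inl p.2))) (arcs F)] l l'
      & same_nodes (nodes D) (map (node_map q) (map (node_map inl) E ++ fnodes F))].

(* Planar isotopies of D and D' are accounted for by the renaming of semiarcs
   and the reordering of nodes in [filled].  That the nodes of F, placed as they
   are in a disk, agree with the planar structure of D follows from the
   clockwise orders: inside F, every region bounded by inner semiarcs only is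
   the face given by these orders. *)
Definition reidemeister_move (D D' : diagram) : Prop :=
  exists (L : finType) (E : seq (node L)) (F F' : fragment L),
    [/\ local_move F F' \/ local_move F' F, filled D E F & filled D' E F'].

(* By the axioms [tvb_underK] to [tvb_virt_virt] and [tvb_mul_rot], these
   conditions depend neither on which semiarc of a strand comes first nor on
   where the clockwise order starts. *)
Definition node_colored (X : tvb) S (f : S -> X) (n : node S) : Prop :=
  match n with
  | Vertex x y z => f x *? f y = Some (f z)
  | Classical a b a' b' => f a' = f a *_ f b /\ f b' = f b *^ f a
  | Virtual a b a' b' => f a' = f a ** f b /\ f b' = f b ** f a
  | TwistBar a b => f b = T (f a)
  end.

Definition is_coloring (X : tvb) (D : diagram) (f : semiarc D -> X) : Prop :=
  Forall (node_colored f) (nodes D).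

Definition colorings (D : diagram) (X : tvb) : Type :=
  {f : semiarc D -> X | is_coloring f}.

(* Main.v *)
(** A coloring of a diagram whose nodes are those outside a disk together with
    those of a fragment F is a coloring g of the strands outside the disk plus
    an extension of g to the inside of F.  For each fragment occurring in a move
    the extension is unique when it exists, so that colorings of the diagram
    correspond to the colorings g of the outside which extend.  The axioms say
    that the two sides of a move impose the same condition on g. *)

From Stdlib Require Import List Permutation.
Require Import Defs.
From mathcomp Require Import all_boot.
From mathcomp Require Import boolp.

Set Implicit Arguments.
Unset Strict Implicit.
Unset Printing Implicit Defensive.

Local Open Scope tvb_scope.

(* The other semiarc of a strand x which passes, in the way [k], a strand with
   semiarc y.  By [pass_pass], either semiarc of that strand can be used. *)
Definition pass (X : tvb) k (x y : X) : X :=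
  match k with Under => x *_ y | Over => x *^ y | Virt => x ** y end.

(* [kxy] says how the strand x passes the strand y. *)
Definition exchange (X : tvb) kxy kxz kyz := forall x y z : X,
  pass kxz (pass kxy x y) (pass (flip kyz) z y)
  = pass kxy (pass kxz x z) (pass kyz y z).

(** * The axioms, stated uniformly for the three kinds of passage *)

Section Passages.
Variable X : tvb.
Implicit Types (x y z w : X) (k : passage).

Lemma flipK : involutive flip.
Proof. by case. Qed.

Lemma passK k y : involutive (fun x => pass k x y).
Proof.
by move=> x; case: k => /=; rewrite ?tvb_overK ?tvb_underK ?tvb_virtK.
Qed.

Lemma pass_pass k x y : pass k x (pass (flip k) y x) = pass k x y.
Proof.
by case: k => /=; rewrite ?tvb_over_under ?tvb_under_over ?tvb_virt_virt.
Qed.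

Lemma pass_flip_pass k x y : pass (flip k) x (pass k y x) = pass (flip k) x y.
Proof. by have:= pass_pass (flip k) x y; rewrite flipK. Qed.

Lemma pass_flip_diag k x : pass (flip k) x x = pass k x x.
Proof. by case: k => //=; rewrite tvb_diag. Qed.

(** Going through a crossing and back: by [pass_pass] either semiarc of the strand of y may be used,
    and passing y twice is the identity. *)
Lemma pass_crossing k x y : pass k (pass k x y) (pass (flip k) y x) = x.
Proof.
have := pass_flip_pass k y (pass k x y); rewrite passK => ->.
by rewrite pass_pass passK.
Qed.

Lemma pass_crossing_flip k x y :
  pass (flip k) (pass (flip k) y x) (pass k x y) = y.
Proof. by have := pass_crossing (flip k) y x; rewrite flipK. Qed.

Lemma crossing_sym k x y x' y' :
  x' = pass k x y /\ y' = pass (flip k) y x <->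
  x = pass k x' y' /\ y = pass (flip k) y' x'.
Proof.
by split=> -[-> ->]; rewrite pass_crossing pass_crossing_flip.
Qed.

(** Only the strand y, y' is reversed here, whereas [crossing_sym] reverses both strands; together
    they allow any side of a crossing to be taken as input. *)
Lemma crossing_turn k x y x' y' :
  x' = pass k x y /\ y' = pass (flip k) y x <->
  x' = pass k x y' /\ y = pass (flip k) y' x.
Proof.
by split=> -[-> ->]; rewrite pass_pass passK.
Qed.

Lemma mul_pass k x y z : omap (fun w => pass k w z) (x *? y)
  = pass k x z *? pass k y (pass (flip k) z x).
Proof.
case: k => /=; [exact: tvb_mul_over | exact: tvb_mul_under
               | exact: tvb_mul_virt].
Qed.

Lemma pass_mul k x y z w :
  y *? z = Some w -> pass k x w = pass k (pass k x y) z.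
Proof.
case: k => /=; [exact: tvb_over_mul | exact: tvb_under_mul
               | exact: tvb_virt_mul].
Qed.

(* [pass k _ w] is an involution, so the two factors can be exchanged. *)
Lemma pass_mulC k x y z w :
  y *? z = Some w -> pass k x w = pass k (pass k x z) y.
Proof.
move=> yz; have := pass_mul k (pass k x w) yz; rewrite passK => {2}->.
by rewrite !passK.
Qed.

(** The algebra behind the IH-move: y(zt) = yw = x, so by associativity yz is defined and (yz)t = x,
    which rotates to tx = yz. *)
Lemma mul_IH x y z t w : x *? y = Some w -> z *? t = Some w ->
  exists2 v, y *? z = Some v & t *? x = Some v.
Proof.
move=> /tvb_mul_rot yw zt; have := tvb_mulA y z t; rewrite zt /= yw.
by case: (y *? z) => //= v /tvb_mul_rot tx; exists v.
Qed.

Lemma mul_crossing k x y : is_classical k ->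
  x *? y = pass (flip k) y x *? pass k x y.
Proof.
by case: k => //= _; [apply: tvb_mul_under_over | apply: tvb_mul_over_under].
Qed.

Lemma bar_pass k x y : is_classical k -> T (pass k (T x) (T y))
  = pass (flip k) (x ** y) (y ** x) ** pass k (y ** x) (x ** y).
Proof. by case: k => //= _; rewrite (tvb_bar_under, tvb_bar_over). Qed.

(** Each hypothesis lets one of the three strands pass the other two in either order. Here w enters
    the strand of z from its far end, so z is the semiarc after the crossing with y. *)
Lemma exchange_triangle kxy kxz kyz x y w (z := pass (flip kyz) w y) :
  exchange X kxy kxz kyz -> exchange X (flip kyz) (flip kxz) (flip kxy) ->
  exchange X (flip kxy) kyz kxz ->
  let x' := pass kxy x y in let y' := pass (flip kxy) y x in
  let w' := pass (flip kxz) w x' in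
  [/\ pass kxz x' w = pass kxy (pass kxz x z) (pass kyz y z),
     pass kyz y' w' = pass (flip kxy) (pass kyz y z) (pass kxz x z)
   & pass (flip kyz) w' y' = pass (flip kxz) z x].
Proof.
move=> ex_xyz ex_zyx ex_yxz x' y' w'.
have zy : pass (flip kyz) z y = w by rewrite /z passK.
(* Exchange for the strand of z: passing y and then x agrees with passing x and then y. *)
have w'E : w' = pass (flip kyz) (pass (flip kxz) z x) y'.
  by rewrite /w' -zy /x' /y' -ex_zyx flipK.
by rewrite w'E pass_pass passK ex_yxz -zy ex_xyz.
Qed.

Lemma exchangeC kxy kxz kyz :
  exchange X kxy kxz kyz -> exchange X kxz kxy (flip kyz).
Proof. by move=> ex x y z; rewrite flipK ex. Qed.

(** The strand x passes y and z in the same way. The axioms settle one value of l, and interchanging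
    y and z settles the other. *)
Lemma exchange_kkl k l :
  is_classical k -> is_classical l -> exchange X k k l.
Proof.
have exO : exchange X Over Over Under by exact: tvb_exch_oo.
have exU : exchange X Under Under Over by exact: tvb_exch_uu.
by case: k; case: l => // _ _; [apply: exchangeC exO | apply: exchangeC exU].
Qed.

Lemma exchange_kll k l :
  is_classical k -> is_classical l -> exchange X k l l.
Proof.
have ex : exchange X Under Over Over by exact: tvb_exch_uo.
case: k; case: l => // _ _; try exact: exchange_kkl.
exact: exchangeC ex.
Qed.

Lemma exchange_kvv k : exchange X k Virt Virt.
Proof.
case: k; [exact: tvb_exch_ov | exact: tvb_exch_uv | exact: tvb_exch_vv].
Qed.

Lemma exchange_vvk k : exchange X Virt Virt k.
Proof.
have exU : exchange X Virt Virt Under by exact: tvb_exch_vo.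
case: k; [exact: (exchangeC exU) | exact: exU | exact: tvb_exch_vv].
Qed.

End Passages.

(** * Extending colorings of the boundary labels into a fragment *)

Section Extensions.
Variable X : tvb.

Definition glue (L : Type) n (g : L -> X) (h : 'I_n -> X) (l : L + 'I_n) : X :=
  match l with inl a => g a | inr i => h i end.

Definition colored_by (L : Type) (F : fragment L) (g : L -> X)
    (h : 'I_(inner F) -> X) : Prop :=
  Forall (node_colored (glue g h)) (fnodes F) /\
  Forall (fun p => g p.1 = g p.2) (arcs F).
Arguments colored_by {L} F g h.

Definition extendable L (F : fragment L) (g : L -> X) : Prop :=
  exists h, colored_by F g h.

Definition rigid L (F : fragment L) (g : L -> X) : Prop :=
  forall h h', colored_by F g h -> colored_by F g h' -> h =1 h'.

(** A move preserves colorings once both of its fragments satisfy this with the same P: the same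
    outer colorings extend, each in one way. *)
Definition uniquely_extendable_iff L (F : fragment L) (g : L -> X) (P : Prop) :=
  rigid F g /\ (extendable F g <-> P).

Lemma node_colored_cross S (f : S -> X) k a b c d :
  node_colored f (cross k a b c d) <->
  f c = pass k (f a) (f b) /\ f d = pass (flip k) (f b) (f a).
Proof.
(* Only [Over] is left: its node lists the under strand b, d first, with the ends c and a of the
   over strand interchanged. *)
case: k => //=; rewrite [X in _ <-> X]and_comm; exact: (crossing_turn Under).
Qed.

Lemma eq_inordP n (h h' : 'I_n.+1 -> X) :
  mkseq (fun k => h (inord k)) n.+1 = mkseq (fun k => h' (inord k)) n.+1 ->
  h =1 h'.
Proof.
move=> /eq_in_map eq_h i; rewrite -(inord_val i); apply: eq_h.
by rewrite mem_iota /= ltn_ord.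
Qed.

(** For fragments whose inner colors are explicit functions of g: s lists these colors, and P is the
    condition left on g. *)
Lemma total_extension L n ns as_ (g : L -> X) s P :
  let F := @Fragment L n.+1 ns as_ in size s = n.+1 ->
  (forall h, colored_by F g h <->
     mkseq (fun k => h (inord k)) n.+1 = s /\ P) ->
  uniquely_extendable_iff F g P.
Proof.
move=> F size_s FP; split=> [h h' /FP[hs _] /FP[h's _]|].
  by apply: eq_inordP; rewrite hs h's.
split=> [[h /FP[]] //|HP]; case: s size_s FP => // x0 s size_s FP.
(* The default [x0] is never reached, since the list has n+1 entries. *)
exists (fun i => nth x0 (x0 :: s) i); apply/FP; split=> //.
apply: (@eq_from_nth _ x0) => [|i]; first by rewrite size_mkseq.
by rewrite size_mkseq => lt_i; rewrite nth_mkseq ?inordK.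
Qed.

Lemma empty_extension L ns as_ (g : L -> X) P :
  let F := @Fragment L 0 ns as_ in
  (forall h, colored_by F g h <-> P) -> uniquely_extendable_iff F g P.
Proof.
move=> F FP; split=> [h h' _ _ []//|]; split=> [[h /FP]//|HP].
have h : 'I_0 -> X by case.
by exists h; apply/FP.
Qed.

(** For an inner color given by a partial product, which may be undefined: Q has at most one
    solution, but no explicit value is available. *)
Lemma single_extension L ns as_ (g : L -> X) (Q : X -> Prop) :
  let F := @Fragment L 1 ns as_ in
  (forall h, colored_by F g h <-> Q (h (inord 0))) ->
  (forall x y, Q x -> Q y -> x = y) ->
  uniquely_extendable_iff F g (exists x, Q x).
Proof.
move=> F FQ Q1; split=> [h h' /FQ Qh /FQ Qh' i|].
  by rewrite (ord1 i) -(inord_val ord0); apply: Q1.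
split=> [[h /FQ Qh]|[x Qx]]; first by exists (h (inord 0)).
by exists (fun=> x); apply/FQ.
Qed.

Lemma eq_uniquely_extendable L (F : fragment L) (g : L -> X) P P' :
  uniquely_extendable_iff F g P -> (P <-> P') -> uniquely_extendable_iff F g P'.
Proof. by case=> rF eF PP'; split=> //; rewrite eF. Qed.

(** * The condition imposed by each fragment, and its agreement across each move *)

Section Fragments.
Variables (L : Type) (g : L -> X).
Implicit Types (a b c d : L) (k : passage).

Local Ltac expand_colored_by :=
  rewrite /colored_by /mkseq /= ?Forall_cons_iff ?Forall_nil_iff
    ?node_colored_cross /=.

(** Reading the crossing backwards from the inner color x gives [pass k x x = g a] and
    [pass (flip k) x x = g b], which agree by axiom (i). *)
Lemma kink_extendable k a b : uniquely_extendable_iff (kink k a b) g (g a = g b).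
Proof.
apply: (@total_extension _ _ _ _ _ [:: pass k (g a) (g a)]) => // h.
expand_colored_by; move: (h _) => x.
split=> [[[[xa xb] _] _]|[[->] ->]]; last first.
  by rewrite pass_flip_diag.
have xx : pass k x x = g a by rewrite {1}xa xb pass_crossing.
have xx' : pass k x x = g b.
  by rewrite -pass_flip_diag {1}xb xa pass_crossing_flip.
have := pass_crossing k x x; rewrite pass_flip_diag xx => <-.
by rewrite -xx.
Qed.

(** The second crossing undoes the first, a crossing being an involution. *)
Lemma bigon_extendable k a a' b b' :
  uniquely_extendable_iff (bigon k a a' b b') g (g a = g a' /\ g b = g b').
Proof.
apply: (@total_extension _ _ _ _ _
  [:: pass k (g a) (g b); pass (flip k) (g b) (g a)]) => // h.
expand_colored_by; move: (h (inord 0)) (h (inord 1)) => x y.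
split=> [[[/crossing_turn[xa yb] [/crossing_sym[-> ->] _]] _]|[[-> ->] [<- <-]]].
  by rewrite xa yb pass_crossing pass_crossing_flip.
by do !split; rewrite ?pass_pass ?pass_flip_pass ?passK.
Qed.

Section Triangles.
Variables (kab kac kbc : passage) (a b c a' b' c' : L).
Hypotheses (ex_abc : exchange X kab kac kbc)
  (ex_cba : exchange X (flip kbc) (flip kac) (flip kab))
  (ex_bac : exchange X (flip kab) kbc kac).

(** The color of the strand c, c' between its two crossings in [triangle]. The ends a, b, c' serve
    as input, and P gives the other three. *)
Let z := pass (flip kbc) (g c') (g b).
Let P := [/\ g a' = pass kab (pass kac (g a) z) (pass kbc (g b) z),
    g b' = pass (flip kab) (pass kbc (g b) z) (pass kac (g a) z)
  & g c = pass (flip kac) z (g a)].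

Lemma triangle_extendable : uniquely_extendable_iff
  (triangle kab kac kbc a b c a' b' c') g P.
Proof.
apply: (@total_extension _ _ _ _ _
  [:: pass kac (g a) z; pass kbc (g b) z; z]) => // h.
expand_colored_by; move: (h (inord 0)) (h (inord 1)) (h (inord 2)) => h0 h1 h2.
rewrite /P; have -> : pass kbc (g b) z = pass kbc (g b) (g c') by rewrite pass_pass.
by split=> [[[[-> ->] [[-> ->] [[-> ->] _]]] _]|[[-> -> ->] [-> -> ->]]].
Qed.

Lemma triangle'_extendable : uniquely_extendable_iff
  (triangle' kab kac kbc a b c a' b' c') g P.
Proof.
(* This rewrites P into the colors found along [triangle'], where a and b cross first. *)
have [] := exchange_triangle (g a) (g b) (g c') ex_abc ex_cba ex_bac.
rewrite -/z /P => <- <- <-.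
apply: (@total_extension _ _ _ _ _ [:: pass kab (g a) (g b);
  pass (flip kab) (g b) (g a); pass (flip kac) (g c') (pass kab (g a) (g b))]) => // h.
expand_colored_by; move: (h (inord 0)) (h (inord 1)) (h (inord 2)) => h0 h1 h2.
by split=> [[[[-> ->] [[-> ->] [[-> ->] _]]] _]|[[-> -> ->] [-> -> ->]]].
Qed.

End Triangles.

Lemma triangle_move kab kac kbc a b c a' b' c' :
  exchange X kab kac kbc -> exchange X (flip kbc) (flip kac) (flip kab) ->
  exchange X (flip kab) kbc kac ->
  exists P,
    uniquely_extendable_iff (triangle kab kac kbc a b c a' b' c') g P /\
    uniquely_extendable_iff (triangle' kab kac kbc a b c a' b' c') g P.
Proof.
move=> ex_abc ex_cba ex_bac; eexists; split; first exact: triangle_extendable.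
exact: triangle'_extendable.
Qed.

Lemma vertex_extendable a b c :
  uniquely_extendable_iff (vertex a b c) g (g a *? g b = Some (g c)).
Proof. by apply: empty_extension => h; expand_colored_by; tauto. Qed.

Lemma twisted_vertex_extendable k a b c :
  uniquely_extendable_iff (twisted_vertex k a b c) g
    (pass (flip k) (g b) (g a) *? pass k (g a) (g b) = Some (g c)).
Proof.
apply: (@total_extension _ _ _ _ _
  [:: pass k (g a) (g b); pass (flip k) (g b) (g a)]) => // h.
expand_colored_by; move: (h (inord 0)) (h (inord 1)) => h0 h1.
by split=> [[[[-> ->] [-> _]] _]|[[-> ->] ->]].
Qed.

Lemma barred_vertex_extendable a b c :
  uniquely_extendable_iff (barred_vertex a b c) g
    (T (g a) *? T (g b) = Some (T (g c))).
Proof.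
apply: (@total_extension _ _ _ _ _ [:: T (g a); T (g b); T (g c)]) => // h.
expand_colored_by; move: (h (inord 0)) (h (inord 1)) (h (inord 2)) => h0 h1 h2.
by split=> [[[-> [-> [-> [-> _]]]] _]|[[-> -> ->] ->]].
Qed.

Section VertexStrand.
Variables (k : passage) (a b c d d' : L).
(** The color of the strand d, d' between the edges a and b in [vertex_strand2]. *)
Let z := pass (flip k) (g d') (g b).
Let P := pass k (g a) z *? pass k (g b) z = Some (g c)
         /\ g d = pass (flip k) z (g a).

Lemma vertex_strand1_extendable :
  uniquely_extendable_iff (vertex_strand1 k a b c d d') g P.
Proof.
(* The product passes the strand factor by factor. Conversely, by [pass_mulC], the strand passes the
   product by passing b and then a. *)
have mulE : omap (fun w => pass k w (pass (flip k) z (g a))) (g a *? g b)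
            = pass k (g a) z *? pass k (g b) z.
  by rewrite mul_pass passK pass_pass.
pose Q x := [/\ g a *? g b = Some x, g c = pass k x (g d')
              & g d = pass (flip k) (g d') x].
apply: (@eq_uniquely_extendable _ _ _ (exists x, Q x)).
  apply: single_extension => [h|x y [+ _ _] [+ _ _]]; last by move=> -> [].
  expand_colored_by; move: (h _) => x; rewrite /Q.
  by split=> [[[-> [[-> ->] _]] _]|[-> -> ->]].
rewrite /P -mulE; split=> [[x [ab -> ->]]|].
  by rewrite -(pass_mulC (flip k) (g d') ab) ab /= pass_pass.
case ab: (g a *? g b) => [x|] /= [] // [cE] dE; exists x.
by rewrite /Q -cE dE -(pass_mulC (flip k) (g d') ab) pass_pass.
Qed.

Lemma vertex_strand2_extendable :
  uniquely_extendable_iff (vertex_strand2 k a b c d d') g P.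
Proof.
apply: (@total_extension _ _ _ _ _
  [:: pass k (g a) z; pass k (g b) z; z]) => // h.
expand_colored_by; move: (h (inord 0)) (h (inord 1)) (h (inord 2)) => h0 h1 h2.
rewrite /P; have -> : pass k (g b) z = pass k (g b) (g d') by rewrite pass_pass.
by split=> [[[[-> ->] [[-> ->] [-> _]]] _]|[[-> -> ->] [-> ->]]].
Qed.

End VertexStrand.

Lemma edge_ab_cd_extendable a b c d :
  uniquely_extendable_iff (edge_ab_cd a b c d) g
   (exists x, g a *? g b = Some x /\ g c *? g d = Some x).
Proof.
apply: single_extension => [h|x y [+ _] [+ _]]; last by move=> -> [].
by expand_colored_by; tauto.
Qed.

Lemma edge_bc_da_extendable a b c d :
  uniquely_extendable_iff (edge_ab_cd b c d a) g
   (exists x, g a *? g b = Some x /\ g c *? g d = Some x).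
Proof.
apply: eq_uniquely_extendable (edge_ab_cd_extendable b c d a) _.
split=> -[x [xP xQ]]; have [y] := mul_IH xP xQ; last by exists y.
by exists y.
Qed.

Lemma bars2_extendable a b : uniquely_extendable_iff (bars2 a b) g (g a = g b).
Proof.
apply: (@total_extension _ _ _ _ _ [:: T (g a)]) => // h.
expand_colored_by; move: (h _) => x.
by split=> [[[-> [-> _]] _]|[[->] ->]]; rewrite tvb_barK.
Qed.

Lemma bar_virtual_extendable a b c d : uniquely_extendable_iff
  (bar_virtual a b c d) g (g c = T (g a) ** g b /\ g d = g b ** T (g a)).
Proof.
apply: (@total_extension _ _ _ _ _ [:: T (g a)]) => // h.
expand_colored_by; move: (h _) => x.
by split=> [[[-> [[-> ->] _]] _]|[[->] [-> ->]]].
Qed.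

Lemma virtual_bar_extendable a b c d : uniquely_extendable_iff
  (virtual_bar a b c d) g (g c = T (g a ** g b) /\ g d = g b ** g a).
Proof.
apply: (@total_extension _ _ _ _ _ [:: g a ** g b]) => // h.
expand_colored_by; move: (h _) => x.
by split=> [[[[-> ->] [-> _]] _]|[[->] [-> ->]]].
Qed.

Lemma barred_crossing_extendable k a b c d :
  uniquely_extendable_iff (barred_crossing k a b c d) g
    (T (g c) = pass k (T (g a)) (T (g b)) /\
     T (g d) = pass (flip k) (T (g b)) (T (g a))).
Proof.
apply: (@total_extension _ _ _ _ _
  [:: T (g a); T (g b); T (g c); T (g d)]) => // h.
expand_colored_by.
move: (h (inord 0)) (h (inord 1)) (h (inord 2)) (h (inord 3)) => h0 h1 h2 h3.
by split=> [[[-> [-> [-> [-> [[-> ->] _]]]]] _]|[[-> -> -> ->] [-> ->]]].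
Qed.

(** The colors are computed from the ends a and d of the first virtual crossing; [bar_pass]
    recognizes the result as a crossing conjugated by T. *)
Lemma virtual_classical_virtual_extendable k a b c d : is_classical k ->
  uniquely_extendable_iff (virtual_classical_virtual k a b c d) g
    (g c = T (pass k (T (g a)) (T (g d))) /\
     g b = T (pass (flip k) (T (g d)) (T (g a)))).
Proof.
move=> k_cl; have k'_cl : is_classical (flip k) by case: k k_cl.
rewrite !bar_pass // flipK; set x := g a ** g d; set y := g d ** g a.
apply: (@total_extension _ _ _ _ _
  [:: y; x; pass k y x; pass (flip k) x y]) => // h.
expand_colored_by.
move: (h (inord 0)) (h (inord 1)) (h (inord 2)) (h (inord 3)) => h0 h1 h2 h3.
have t1 := crossing_turn Virt (g a) h0 h1 (g d).
have t2 := crossing_sym (flip k) h3 h2 h1 h0.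
have t3 := crossing_turn Virt h3 (g b) (g c) h2.
rewrite /= in t1 t3; rewrite t1 t2 t3 flipK.
by split=> [[[[-> ->] [[-> ->] [[-> ->] _]]] _]|[[-> -> -> ->] [-> ->]]].
Qed.

Lemma strand_extendable a b : uniquely_extendable_iff (strand a b) g (g a = g b).
Proof. by apply: empty_extension => h; expand_colored_by; tauto. Qed.

Lemma strands2_extendable a a' b b' :
  uniquely_extendable_iff (strands2 a a' b b') g (g a = g a' /\ g b = g b').
Proof. by apply: empty_extension => h; expand_colored_by; tauto. Qed.

Lemma local_move_extendable (F F' : fragment L) : local_move F F' ->
  exists P, uniquely_extendable_iff F g P /\ uniquely_extendable_iff F' g P.
Proof.
have flip_classical k : is_classical k -> is_classical (flip k) by case: k.
case.
- move=> k a b _; exists (g a = g b).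
  by split; [apply: kink_extendable | apply: strand_extendable].
- move=> k a a' b b' _; exists (g a = g a' /\ g b = g b').
  by split; [apply: bigon_extendable | apply: strands2_extendable].
- move=> k a b c a' b' c' k_cl.
  (* In each of the three exchange conditions, either the first two passages agree or the last two
     do. *)
  by apply: triangle_move; (apply: exchange_kll || apply: exchange_kkl); auto.
- move=> k a b c a' b' c' k_cl.
  by apply: triangle_move; (apply: exchange_kll || apply: exchange_kkl); auto.
- move=> k a b c a' b' c' k_cl.
  by apply: triangle_move; (apply: exchange_kll || apply: exchange_kkl); auto.
- move=> a b; exists (g a = g b).
  by split; [apply: kink_extendable | apply: strand_extendable].
- move=> a a' b b'; exists (g a = g a' /\ g b = g b').
  by split; [apply: bigon_extendable | apply: strands2_extendable].
- move=> a b c a' b' c'.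
  by apply: triangle_move; apply: exchange_kvv.
- move=> k a b c a' b' c' _.
  by apply: triangle_move; (apply: exchange_kvv || apply: exchange_vvk).
- move=> k a b c k_cl; eexists; split; first exact: twisted_vertex_extendable.
  by rewrite -mul_crossing //; apply: vertex_extendable.
- move=> k a b c d d' _; eexists; split; first exact: vertex_strand1_extendable.
  exact: vertex_strand2_extendable.
- move=> a b c d; eexists; split; first exact: edge_ab_cd_extendable.
  exact: edge_bc_da_extendable.
- move=> a b; exists (g a = g b).
  by split; [apply: bars2_extendable | apply: strand_extendable].
- move=> a b c d; eexists; split; first exact: bar_virtual_extendable.
  by rewrite -tvb_bar_virt -tvb_virt_bar; apply: virtual_bar_extendable.
- move=> k a b c d k_cl; eexists; split; first exact: barred_crossing_extendable.
  apply: eq_uniquely_extendable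
    (virtual_classical_virtual_extendable _ _ _ _ k_cl) _.
  have barE (x y : X) : x = T y <-> T x = y.
    by split=> [->|<-]; rewrite tvb_barK.
  (* One side is solved from a and b, the other from a and d; reversing the strand b, d matches
     them. *)
  by rewrite (barE (g c)) (barE (g b)); symmetry; apply: crossing_turn.
- move=> a b c; eexists; split; first exact: barred_vertex_extendable.
  apply: eq_uniquely_extendable (twisted_vertex_extendable Virt a b c) _.
  have /= <- := tvb_bar_mul (g a) (g b).
  case: (_ *? _) => //= x.
  by split=> [[]|[->]]; rewrite ?tvb_barK // => <-; rewrite tvb_barK.
- move=> a b c d d'; eexists; split; first exact: vertex_strand1_extendable.
  exact: vertex_strand2_extendable.
Qed.

End Fragments.

End Extensions.
Arguments colored_by {X L} F g h.

(** * From colorings of fragments to colorings of diagrams *)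

Section Filling.
Variable X : tvb.

Lemma ForallP (A : eqType) (P : A -> Prop) (s : seq A) :
  Forall P s <-> {in s, forall x, P x}.
Proof.
elim: s => [|x s IHs]; first by split.
rewrite Forall_cons_iff IHs; split=> [[Px Ps] y|Ps].
  by rewrite inE => /predU1P[->|/Ps].
by split=> [|y ys]; apply: Ps; rewrite inE ?eqxx // ys orbT.
Qed.

Lemma node_colored_map S S' (q : S -> S') (f : S' -> X) n :
  node_colored f (node_map q n) <-> node_colored (f \o q) n.
Proof. by case: n. Qed.

Lemma Forall_colored_map S S' (q : S -> S') (f : S' -> X) ns :
  Forall (node_colored f) (map (node_map q) ns)
  <-> Forall (node_colored (f \o q)) ns.
Proof.
elim: ns => //= n ns IHns.
by rewrite !Forall_cons_iff IHns node_colored_map.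
Qed.

Lemma node_colored_turn S (f : S -> X) n :
  node_colored f (turn n) <-> node_colored f n.
Proof.
case: n => [x y z|x y z t|x y z t|x y] /=.
- by rewrite (tvb_mul_rot (f x)).
- by symmetry; apply: (crossing_sym Under).
- by rewrite [X in _ <-> X]and_comm; symmetry; apply: (crossing_turn Virt).
- by split=> ->; rewrite tvb_barK.
Qed.

Lemma node_colored_same S (f : S -> X) n n' :
  same_node n n' -> node_colored f n <-> node_colored f n'.
Proof. by case=> j ->; elim: j => //= j ->; rewrite node_colored_turn. Qed.

Lemma Forall_colored_same S (f : S -> X) ns ns' : same_nodes ns ns' ->
  Forall (node_colored f) ns <-> Forall (node_colored f) ns'.
Proof.
case=> ms ns_ms ms_ns'.
have -> : Forall (node_colored f) ns <-> Forall (node_colored f) ms.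
  split; apply: Permutation_Forall => //; exact: Permutation_sym.
elim: ms_ns' => //= n n' {ns_ms}ms ms' n_n' _ IH.
by rewrite !Forall_cons_iff IH (node_colored_same _ n_n').
Qed.

Variables (D : diagram) (L : finType) (E : seq (node L)) (F : fragment L).

(** F enters only through extendability, which makes the two diagrams of a move comparable. *)
Definition outer_coloring (g : L -> X) :=
  Forall (node_colored g) E /\ extendable F g.

Lemma filled_coloring (q : L + 'I_(inner F) -> semiarc D)
    (f : semiarc D -> X) :
  same_nodes (nodes D) (map (node_map q) (map (node_map inl) E ++ fnodes F)) ->
  is_coloring f <-> Forall (node_colored (f \o q \o inl)) E /\
                    Forall (node_colored (f \o q)) (fnodes F).
Proof.
move=> nodesD; rewrite /is_coloring (Forall_colored_same _ nodesD).
by rewrite Forall_colored_map Forall_app Forall_colored_map.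
Qed.

(** The bijection restricts a coloring to the outer labels. Rigidity makes it injective; it is
    surjective because q identifies only labels joined by arcs, along which colors agree. *)
Lemma filled_colorings : filled D E F ->
  (forall g : L -> X, rigid F g) ->
  exists phi : colorings D X -> {g | outer_coloring g}, bijective phi.
Proof.
case=> q [q_surj q_eq nodesD] rigidF.
have fE (f : semiarc D -> X) :
    f \o q =1 glue (f \o q \o inl) (f \o q \o inr) by case.
have colored_inner (f : semiarc D -> X) : is_coloring f ->
    colored_by F (f \o q \o inl) (f \o q \o inr).
  move=> /(filled_coloring _ nodesD)[_ Ff]; split; first by rewrite -(funext (fE f)).
  apply/ForallP => p p_arc /=; congr f; apply/q_eq/connect1/hasP.
  by exists p => //=; rewrite !eqxx.
have outer (f : semiarc D -> X) : is_coloring f -> outer_coloring (f \o q \o inl).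
  move=> f_col; split; last by exists (f \o q \o inr); apply: colored_inner.
  by have /(filled_coloring _ nodesD)[] := f_col.
pose phi (f : colorings D X) : {g | outer_coloring g} :=
  exist _ _ (outer _ (svalP f)).
have phi_inj : injective phi.
  move=> [f f_col] [f' f'_col] /(congr1 sval) /= eq_outer.
  apply: eq_exist; apply: funext => s; have [l <-] := q_surj s.
  case: l => [l|i]; first exact: (congr1 (@^~ l) eq_outer).
  have := colored_inner f' f'_col; rewrite -eq_outer => f'_in.
  exact: (rigidF _ _ _ (colored_inner f f_col) f'_in i).
have phi_surj g : exists f, phi f = g.
  case: g => g [gE [h [hF arcsF]]].
  (* The glued coloring descends along q, by induction on a path of arcs. *)
  have glue_q l l' : q l = q l' -> glue g h l = glue g h l'.
    move=> /q_eq /connectP[p]; elim: p l => [|x p IHp] l /=; first by move=> _ ->.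
    case/andP=> /hasP[[a b] ab_arc /= lx] xp l'E; rewrite -(IHp x xp l'E).
    move/ForallP: arcsF => /(_ _ ab_arc) /= gab.
    by case/orP: lx => /andP[/eqP-> /eqP->] /=.
  have q_ex s : exists l, q l == s by have [l <-] := q_surj s; exists l.
  (* The chosen preimage of s is immaterial by [glue_q]. *)
  pose f s := glue g h (xchoose (q_ex s)).
  have fq l : (f \o q) l = glue g h l.
    by apply: glue_q; apply/eqP; apply: (xchooseP (q_ex (q l))).
  have f_col : is_coloring f.
    by apply/(filled_coloring _ nodesD); rewrite (funext fq).
  exists (exist _ f f_col); apply: eq_exist; apply: funext => l /=.
  exact: (fq (inl l)).
exists phi; exists (fun g => sval (cid (phi_surj g))).
  by move=> f; apply: phi_inj; case: cid.
by move=> g; case: cid.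
Qed.

End Filling.

Theorem theorem1 (X : tvb) (D D' : diagram) (hDD' : reidemeister_move D D') :
  exists phi : colorings D X -> colorings D' X, bijective phi.
Proof.
have [L [E [F [F' [moveF fillD fillD']]]]] := hDD'.
have move_ext g : exists P,
    uniquely_extendable_iff F g P /\ @uniquely_extendable_iff X L F' g P.
  case: moveF => /(@local_move_extendable X L g) [P []]; by exists P.
have [|phi bij_phi] := @filled_colorings X _ _ _ _ fillD.
  by move=> g; have [P [[]]] := move_ext g.
have [|phi' bij_phi'] := @filled_colorings X _ _ _ _ fillD'.
  by move=> g; have [P [_ []]] := move_ext g.
(* Equality of predicates, rather than equivalence, identifies the two subtypes, so the bijections
   compose. *)
have eq_outer : outer_coloring E F = outer_coloring E F' :> ((L -> X) -> Prop).
  apply: funext => g; apply: propext; rewrite /outer_coloring.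
  by have [P [[_ ->] [_ ->]]] := move_ext g.
rewrite -eq_outer in phi' bij_phi'.
case: bij_phi' => psi psiK phi'K.
exists (psi \o phi); apply: bij_comp => //.
by exists phi'.
Qed.
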